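(* Let $\mu$ be a quasi-definite complex Borel measure on the unit torus $\mathbb{T}^D$ with moment matrix $G$, and let $\phi_{[k]},\hat\phi_{[k]}$ ($k\ge 0$) be the associated blocks of multivariate biorthogonal Laurent polynomials. Then $$\phi_{[k]}(z)=\Theta_*\begin{pmatrix} G_{[0],[0]} & \cdots & G_{[0],[k-1]} & \chi_{[0]}(z)\\ \vdots & & \vdots & \vdots\\ G_{[k],[0]} & \cdots & G_{[k],[k-1]} & \chi_{[k]}(z)\end{pmatrix},\qquad \big(\hat\phi_{[k]}(z)\big)^\dagger=\Theta_*\begin{pmatrix} G_{[0],[0]} & \cdots & G_{[0],[k]}\\ \vdots & & \vdots\\ G_{[k-1],[0]} & \cdots & G_{[k-1],[k]}\\ \big(\chi_{[0]}(z)\big)^\dagger & \cdots & \big(\chi_{[k]}(z)\big)^\dagger\end{pmatrix}.$$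
   Context: Let $D\ge1$, $\mathbb{T}=\{z\in\mathbb{C}:|z|=1\}$, $z(\theta)=(e^{i\theta_1},\dots,e^{i\theta_D})$. For $\alpha\in\mathbb{Z}^D$ put $|\alpha|=\sum_a|\alpha_a|$ (the longitude) and $z^\alpha=z_1^{\alpha_1}\cdots z_D^{\alpha_D}$. Let $[k]=\{\alpha\in\mathbb{Z}^D:|\alpha|=k\}$, with cardinality $|[k]|$. Multi-indices are ordered first by longitude and, within each $[k]$, lexicographically. $\chi_{[k]}(z)$ is the column vector of the monomials $z^\alpha$, $\alpha\in[k]$, and $\chi=(\chi_{[0]};\chi_{[1]};\dots)$. Semi-infinite matrices are indexed by $\mathbb{Z}^D$ in this order, with blocks $A_{[k],[l]}$; $A^{[k]}$ is the truncation to the blocks with indices $0,\dots,k-1$. The moment matrix of $\mu$ is $G=\oint_{\mathbb{T}^D}\chi(z(\theta))\,d\mu(\theta)\,\chi(z(\theta))^\dagger$, i.e. $G_{\alpha,\beta}=\oint e^{i(\alpha-\beta)\cdot\theta}d\mu(\theta)$. The measure is quasi-definite if $\det G^{[k]}\neq0$ for all $k\ge 1$; then there is a unique factorization $G=S^{-1}H(\hat S^{-1})^\dagger$ with $S,\hat S$ block lower unitriangular and $H=\operatorname{diag}(H_{[0]},H_{[1]},\dots)$ block diagonal with invertible blocks. Set $\Phi=S\chi$ and $\hat\Phi=\hat S\chi$, with blocks $\phi_{[k]}$, $\hat\phi_{[k]}$. The last quasi-determinant of a block matrix whose upper-left block $A$ is square and invertible is $\Theta_*\begin{pmatrix}A&B\\C&E\end{pmatrix}=E-CA^{-1}B$.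 Here $A=G^{[k]}$ (for $k=0$, $A$ is empty and $\Theta_*$ returns $E$), and $E$ is the last block entry. *)

(* Defs.v *)
From HB Require Import structures.
From mathcomp Require Import all_boot all_order all_algebra.
From mathcomp Require Import zify spectral complex.
From mathcomp Require Import all_classical all_reals all_analysis.

Set Implicit Arguments.
Unset Strict Implicit.
Unset Printing Implicit Defensive.

Import Order.TTheory GRing.Theory Num.Theory.
Import numFieldTopology.Exports numFieldNormedType.Exports.

Local Open Scope classical_set_scope.
Local Open Scope sesquilinear_scope.
Local Open Scope ring_scope.

(* The topology of R[i] given by its modulus: the library attaches it to
   abstract numeric fields only. *)
HB.instance Definition _ (R : realType) :=
  NormedModule.copy R[i] (R[i]^o).

Section ComplexMeasure.
Context {d : measure_display} (T : measurableType d) (R : realType).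

(* Values on non-measurable sets are irrelevant: both the axiom and the
   integral below only see measurable sets. *)
Record complex_measure := ComplexMeasure {
  cmeasure :> set T -> R[i];
  cmeasure_sigma_additive : forall F : (set T)^nat,
    (forall n, measurable (F n)) -> trivIset setT F ->
    (fun n => \sum_(0 <= i < n) cmeasure (F i)) @ \oo
      --> cmeasure (\bigcup_n F n) }.

Variable mu : complex_measure.

Definition re_part (A : set T) : \bar R := (complex.Re (mu A))%:E.
Definition im_part (A : set T) : \bar R := (complex.Im (mu A))%:E.

Lemma ler_norm_Re (z : R[i]) : (`|complex.Re z|%:C)%C <= `|z|.
Proof.
case: z => a b; rewrite normc_def lecR /= -sqrtr_sqr ler_sqrt ?lerDl ?sqr_ge0//.
by rewrite addr_ge0 ?sqr_ge0.
Qed.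

Lemma ler_norm_Im (z : R[i]) : (`|complex.Im z|%:C)%C <= `|z|.
Proof.
case: z => a b; rewrite normc_def lecR /= -sqrtr_sqr ler_sqrt ?lerDr ?sqr_ge0//.
by rewrite addr_ge0 ?sqr_ge0.
Qed.

Lemma cvg_part (p : {additive R[i] -> R}) :
  (forall z, (`|p z|%:C)%C <= `|z|) ->
  forall (u : (R[i])^nat) (l : R[i]),
    u @ \oo --> l -> (fun n => p (u n)) @ \oo --> p l.
Proof.
move=> ple u l ul; apply/cvgrPdist_lt => e e0.
have eC : (0 : R[i]) < (e%:C)%C by rewrite ltcR.
move/cvgrPdist_lt : ul => /(_ _ eC); apply: filterS => n ln.
by rewrite -raddfB -ltcR; exact: le_lt_trans ln.
Qed.

Lemma cmeasure0 : mu set0 = 0.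
Proof.
have := @cmeasure_sigma_additive mu (fun=> set0) (fun=> measurable0)
  (@trivIset_set0 _ _ setT).
rewrite bigcup0// => h0.
have cs : (fun n => \sum_(0 <= i < n.+1) mu set0) @ \oo --> mu set0.
  by rewrite (cvg_shiftS (fun n => \sum_(0 <= i < n) mu set0)).
have : (fun n => \sum_(0 <= i < n.+1) mu set0 - \sum_(0 <= i < n) mu set0)
   @ \oo --> mu set0 - mu set0 by exact: cvgB.
rewrite subrr; under eq_fun do rewrite big_nat_recr//= [_ + mu set0]addrC addrK.
by move=> h; apply: (cvg_unique _ (cvg_cst (mu set0)) h).
Qed.

Lemma part_sigma_additive (p : {additive R[i] -> R}) :
  (forall z, (`|p z|%:C)%C <= `|z|) ->
  semi_sigma_additive (fun A => (p (mu A))%:E).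
Proof.
move=> ple F mF tF _.
rewrite (_ : (fun n => _) =
    EFin \o (fun n => p (\sum_(0 <= i < n) mu (F i)))); last first.
  by apply/funext => n /=; rewrite raddf_sum sumEFin.
apply: cvg_EFin; first by exact: nearW.
by apply: cvg_part => //; exact: cmeasure_sigma_additive.
Qed.

Let re0 : re_part set0 = 0%E. Proof. by rewrite /re_part cmeasure0. Qed.
Let im0 : im_part set0 = 0%E. Proof. by rewrite /im_part cmeasure0. Qed.

Let re_fin A : measurable A -> re_part A \is a fin_num. Proof. by []. Qed.
Let im_fin A : measurable A -> im_part A \is a fin_num. Proof. by []. Qed.

Let re_additive : semi_sigma_additive re_part.
Proof. exact: part_sigma_additive ler_norm_Re. Qed.

Let im_additive : semi_sigma_additive im_part.
Proof. exact: part_sigma_additive ler_norm_Im. Qed.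

HB.instance Definition _ := isCharge.Build _ T R re_part re0 re_fin re_additive.
HB.instance Definition _ := isCharge.Build _ T R im_part im0 im_fin im_additive.

End ComplexMeasure.

Section Integral.
Context {d : measure_display} {T : measurableType d} {R : realType}.

Definition hahn_pos (nu : {charge set T -> \bar R}) : set T :=
  projT1 (cid (Hahn_decomposition nu)).

Definition hahn_neg (nu : {charge set T -> \bar R}) : set T :=
  projT1 (cid (projT2 (cid (Hahn_decomposition nu)))).

Definition hahnP (nu : {charge set T -> \bar R}) :
    hahn_decomposition nu (hahn_pos nu) (hahn_neg nu) :=
  projT2 (cid (projT2 (cid (Hahn_decomposition nu)))).

(* Integral against a finite signed measure through its Jordan decomposition,
   which does not depend on the chosen Hahn decomposition. *)
Definition charge_integral (nu : {charge set T -> \bar R}) (f : T -> R) : R :=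
  \int[jordan_pos (hahnP nu)]_x f x - \int[jordan_neg (hahnP nu)]_x f x.

Definition cintegral (mu : complex_measure T R) (f : T -> R[i]) : R[i] :=
  let re := charge_integral (re_part mu) in
  let im := charge_integral (im_part mu) in
  ((re (fun x => complex.Re (f x)) - im (fun x => complex.Im (f x))) +i*
   (re (fun x => complex.Im (f x)) + im (fun x => complex.Re (f x))))%C.

End Integral.

Section Torus.
Context (R : realType) (D : nat).

Definition torus_set : set 'rV[R[i]]_D :=
  [set z : 'rV[R[i]]_D | forall a : 'I_D, `|z 0 a| = 1].

Definition torus : Type := set_type torus_set.

HB.instance Definition _ := Topological.copy torus (set_type torus_set).

Lemma torus1 : (const_mx 1 : 'rV[R[i]]_D) \in torus_set.
Proof. by rewrite inE => a; rewrite mxE normr1. Qed.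

HB.instance Definition _ := isPointed.Build torus (SigSub torus1).

Definition borel_torus := g_sigma_algebraType (@open torus).

End Torus.

Section MultiIndex.
Context (D : nat).

Definition multiindex := (D.-tuple int)%type.

Definition longitude (al : multiindex) : nat := (\sum_(a < D) `|tnth al a|)%N.

(* The finite list [k]: every entry of a multi-index of longitude k lies in
   [-k, k], so it suffices to filter the box [-k, k]^D. *)
Definition shell (k : nat) : seq multiindex :=
  sort (fun al be : D.-tuplelexi int => (al <= be)%O)
    [seq al <- [seq map_tuple (fun i : 'I_k.*2.+1 => i%:Z - k%:Z : int) t
                  | t <- enum {: D.-tuple 'I_k.*2.+1}]
       | longitude al == k].

Lemma mem_shell k al : (al \in shell k) = (longitude al == k).
Proof.
rewrite mem_sort mem_filter andb_idr// => /eqP lk.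
have bnd a : (`|tnth al a| <= k)%N.
  by rewrite -lk /longitude (bigD1 a)//= leq_addr.
apply/mapP; exists [tuple inord (absz (tnth al a + k%:Z)%R) | a < D].
  by rewrite mem_enum.
apply: eq_from_tnth => a; rewrite tnth_map tnth_mktuple inordK.
- by have := bnd a; case: (tnth al a) => n; lia.
- by have := bnd a; case: (tnth al a) => n; lia.
Qed.

Lemma uniq_shell k : uniq (shell k).
Proof.
rewrite sort_uniq filter_uniq// map_inj_uniq ?enum_uniq// => s t /(congr1 val)/=.
move=> /inj_map st; apply: val_inj; apply: st => i j /addIr [] ij.
exact: val_inj.
Qed.

Lemma sorted_shell k :
  sorted (fun al be : D.-tuplelexi int => (al <= be)%O) (shell k).
Proof. by apply: sort_sorted => al be; exact: le_total. Qed.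

Definition shell_card (k : nat) : nat := size (shell k).

Definition shell_nth (k : nat) (i : 'I_(shell_card k)) : multiindex :=
  tnth (in_tuple (shell k)) i.

End MultiIndex.

Section SemiInfinite.
Context {C : numClosedFieldType} {D : nat}.

Definition semimx := multiindex D -> multiindex D -> C.

Definition semicv := multiindex D -> C.

Definition mblock (A : semimx) (k l : nat)
    : 'M[C]_(shell_card D k, shell_card D l) :=
  \matrix_(i, j) A (shell_nth i) (shell_nth j).

Definition vblock (v : semicv) (k : nat) : 'cV[C]_(shell_card D k) :=
  \col_i v (shell_nth i).

Definition trunc (A : semimx) (k : nat)
    : 'M[C]_(\sum_(i < k) shell_card D i) :=
  \mxblock_(i < k, j < k) mblock A i j.

Definition semi_id : semimx := fun al be => (al == be)%:R.

Definition semi_adj (A : semimx) : semimx := fun al be => (A be al)^*.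

(* Product A B for a block lower triangular left factor A: the sum over all
   multi-indices reduces to those of longitude at most |al|. *)
Definition semi_mul (A B : semimx) : semimx := fun al be =>
  \sum_(0 <= m < (longitude al).+1) \sum_(ga <- shell D m) A al ga * B ga be.

Definition semi_mulv (A : semimx) (v : semicv) : semicv := fun al =>
  \sum_(0 <= m < (longitude al).+1) \sum_(ga <- shell D m) A al ga * v ga.

Definition block_lower (A : semimx) : Prop :=
  forall al be, (longitude al < longitude be)%N -> A al be = 0.

Definition block_lower_unitri (A : semimx) : Prop :=
  block_lower A /\ forall k, mblock A k k = 1%:M.

Definition block_diag_unit (H : semimx) : Prop :=
  (forall al be, longitude al <> longitude be -> H al be = 0) /\
  (forall k, mblock H k k \in unitmx).

Definition lower_inverse (A B : semimx) : Prop :=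
  [/\ block_lower B, semi_mul A B = semi_id & semi_mul B A = semi_id].

(* G = S^-1 H (Sh^-1)^dagger; the left factors T and T H of the two products
   are block lower triangular, as semi_mul requires. *)
Definition gauss_borel (G S H Sh : semimx) : Prop :=
  [/\ block_lower_unitri S, block_lower_unitri Sh, block_diag_unit H &
   exists T Th, [/\ lower_inverse S T, lower_inverse Sh Th &
     G = semi_mul (semi_mul T H) (semi_adj Th)]].

(* invmx is a true inverse only on invertible blocks, the only case in which
   the last quasi-determinant is meant to be used. *)
Definition last_quasidet (n p q : nat) (M : 'M[C]_(n + p, n + q))
    : 'M[C]_(p, q) :=
  drsubmx M - dlsubmx M *m invmx (ulsubmx M) *m ursubmx M.

Definition chi (z : 'rV[C]_D) : semicv :=
  fun al => \prod_(a < D) z 0 a ^ tnth al a.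

End SemiInfinite.

Arguments semimx : clear implicits.
Arguments semicv : clear implicits.

Section Moment.
Context {R : realType} {D : nat}.

Definition moment (mu : complex_measure (borel_torus R D) R)
    : semimx R[i] D := fun al be =>
  cintegral mu (fun z => chi (set_val z) al * (chi (set_val z) be)^*).

Definition quasi_definite (mu : complex_measure (borel_torus R D) R) : Prop :=
  forall k, (1 <= k)%N -> \det (trunc (moment mu) k) != 0.

End Moment.

(* Main.v *)
(* From G = S^-1 H (Sh^-1)^dagger, the product S G = H (Sh^-1)^dagger is block
   upper triangular and G Sh^dagger = S^-1 H is block lower triangular.  Their
   vanishing blocks (k, l), l < k, resp. (i, k), i < k, are linear systems with
   matrix the truncation of G, whose solutions are the strictly lower part of
   the block row k of S, resp. its adjoint for Sh; substituting them in S chi and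
   (Sh chi)^dagger gives the Schur complements. *)
Require Import Defs.
From HB Require Import structures.
From mathcomp Require Import all_boot all_order all_algebra.
From mathcomp Require Import spectral complex.
From mathcomp Require Import all_classical all_reals all_analysis.

Set Implicit Arguments.
Unset Strict Implicit.
Unset Printing Implicit Defensive.

Import Order.TTheory GRing.Theory Num.Theory.
Import numFieldTopology.Exports numFieldNormedType.Exports.

Local Open Scope sesquilinear_scope.
Local Open Scope ring_scope.

(** Meant for the empty truncation, whose size [\sum_(i < 0) _] is 0 only up to a provable equation;
    hence the hypothesis [n = 0]. *)
Lemma unitmx_size0 (C : fieldType) (n : nat) (M : 'M[C]_n) :
  n = 0 -> M \in unitmx.
Proof. by move=> n0; subst n; rewrite flatmx0 unitmxE det_mx00 unitr1. Qed.

Lemma longitude_shell_nth (D k : nat) (i : 'I_(shell_card D k)) :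
  longitude (shell_nth i) = k.
Proof. by apply/eqP; rewrite -mem_shell mem_tnth. Qed.

(** * Blocks and truncations of semi-infinite matrices *)

Section Blocks.
Context {C : numClosedFieldType} {D : nat}.
Implicit Types A B : semimx C D.

Lemma block_lowerE A k l : block_lower A -> (k < l)%N -> mblock A k l = 0.
Proof.
by move=> lA kl; apply/matrixP => i j; rewrite !mxE lA ?longitude_shell_nth.
Qed.

Lemma mblock_adj A k l : mblock (semi_adj A) k l = (mblock A l k)^t*.
Proof. by apply/matrixP => i j; rewrite !mxE. Qed.

Lemma mblock_id k l : k != l -> mblock (@semi_id C D) k l = 0.
Proof.
move=> /eqP kl; apply/matrixP => i j; rewrite !mxE /semi_id; case: eqP => //.
by move=> /(congr1 (@longitude D)); rewrite !longitude_shell_nth.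
Qed.

Lemma mblock_id_diag k : mblock (@semi_id C D) k k = 1%:M.
Proof.
apply/matrixP => i j; rewrite !mxE /semi_id /shell_nth.
rewrite !(tnth_nth (shell_nth i)) /=.
by rewrite nth_uniq ?uniq_shell.
Qed.

Lemma mblock_mul A B k l :
  mblock (semi_mul A B) k l = \sum_(m < k.+1) mblock A k m *m mblock B m l.
Proof.
apply/matrixP => i j; rewrite mxE /semi_mul longitude_shell_nth.
rewrite big_mkord summxE.
apply: eq_bigr => m _; rewrite mxE big_tnth; apply: eq_bigr => n _.
by rewrite !mxE.
Qed.

(** The added terms, with k < m, vanish by triangularity; a bound common to all block rows is what a
    finite matrix product needs. *)
Lemma mblock_mul_lower N A B k l : block_lower A -> (k < N)%N ->
  mblock (semi_mul A B) k l = \sum_(m < N) mblock A k m *m mblock B m l.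
Proof.
move=> lA kN; rewrite mblock_mul.
rewrite (big_ord_widen N (fun m => mblock A k m *m mblock B m l))//.
rewrite big_mkcond; apply: eq_bigr => m _; case: ltnP => // km.
by rewrite block_lowerE ?mul0mx.
Qed.

Lemma vblock_mulv A (v : semicv C D) k :
  vblock (semi_mulv A v) k = \sum_(m < k.+1) mblock A k m *m vblock v m.
Proof.
apply/matrixP => i j; rewrite mxE /semi_mulv longitude_shell_nth.
rewrite big_mkord summxE.
apply: eq_bigr => m _; rewrite mxE big_tnth; apply: eq_bigr => n _.
by rewrite !mxE.
Qed.

Lemma block_lower_mul A B : block_lower A -> block_lower B ->
  block_lower (semi_mul A B).
Proof.
move=> lA lB al be ab; rewrite /semi_mul big_nat_cond big1// => m.
rewrite andbT ltnS /= => ma; rewrite big_seq big1// => ga.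
by rewrite mem_shell => /eqP gm; rewrite (lB ga) ?mulr0// gm (leq_ltn_trans ma).
Qed.

(** The first N block rows of [A] meet only the first N block rows of [B]. Products can then be
    reassociated among finite matrices. *)
Lemma trunc_mul N A B : block_lower A ->
  trunc (semi_mul A B) N = trunc A N *m trunc B N.
Proof.
move=> lA; rewrite /trunc mul_mxblock; apply: eq_mxblock => i j.
exact: mblock_mul_lower.
Qed.

Lemma trunc_id N : trunc (@semi_id C D) N = 1%:M.
Proof.
(* Seen as a block diagonal matrix, the identity carries a size cast [conform_mx] on its diagonal
   blocks. *)
rewrite -mxdiagZ; apply: eq_mxblock => i j; case: eqVneq => [<-|ij].
  by rewrite conform_mx_id mblock_id_diag.
by rewrite mblock_id.
Qed.

Lemma trunc_adj N A : trunc (semi_adj A) N = (trunc A N)^t*.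
Proof.
by rewrite /trunc tr_mxblock; apply/matrixP => s t; rewrite !mxE.
Qed.

Lemma trunc_mblock N A i j : submxblock (trunc A N) i j = mblock A i j.
Proof. exact: mxblockK. Qed.

Lemma adjmxM m n p (A : 'M[C]_(m, n)) (B : 'M[C]_(n, p)) :
  (A *m B)^t* = B^t* *m A^t*.
Proof. by rewrite trmx_mul map_mxM. Qed.

Lemma block_diag_lower A : block_diag_unit A -> block_lower A.
Proof. by move=> [dA _] al be lt; apply: dA => e; rewrite e ltnn in lt. Qed.

Lemma mblock_diag A k l : block_diag_unit A -> k != l -> mblock A k l = 0.
Proof.
move=> [dA _] /eqP kl; apply/matrixP => i j.
by rewrite !mxE dA// !longitude_shell_nth.
Qed.

(** * Linear systems given by the Gauss-Borel factorization *)

Section GaussBorel.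
Variables G S H Sh : semimx C D.
Hypothesis GSH : gauss_borel G S H Sh.

Lemma gauss_borel_left k l : (l < k)%N -> mblock (semi_mul S G) k l = 0.
Proof.
case: GSH => -[lS _] _ dH [T [Th [[lT ST _] [lTh _ _] GE]]] lk.
have lH := block_diag_lower dH.
have lTH := block_lower_mul lT lH.
(* Size [k.+1] is the least one that contains block row k. *)
have SGE : trunc (semi_mul S G) k.+1 = trunc (semi_mul H (semi_adj Th)) k.+1.
  rewrite GE !trunc_mul// !mulmxA -(trunc_mul _ T lS).
  by rewrite ST trunc_id mul1mx.
have l1 : (l < k.+1)%N by exact: ltnW.
rewrite -(trunc_mblock (semi_mul S G) (@ord_max k) (Ordinal l1)) SGE.
rewrite trunc_mblock mblock_mul big1 //= => m _.
(* Only m = k survives in [H]; the other factor is then the adjoint of the block (l, k) of [Th],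
   zero since l < k. *)
have [km|km] := eqVneq k m; last by rewrite mblock_diag ?mul0mx.
by rewrite mblock_adj [mblock Th _ _]block_lowerE -?km// trmx0 map_mx0 mulmx0.
Qed.

(* The product G Sh^dagger, written out since semi_mul would truncate it: its
   left factor is not block lower triangular. *)
Lemma gauss_borel_right i k : (i < k)%N ->
  \sum_(m < k.+1) mblock G i m *m (mblock Sh k m)^t* = 0.
Proof.
case: GSH => _ [lSh _] dH [T [Th [[lT _ _] [_ ShT _] GE]]] ik.
have lH := block_diag_lower dH.
have lTH := block_lower_mul lT lH.
have GShE :
    trunc G k.+1 *m trunc (semi_adj Sh) k.+1 = trunc (semi_mul T H) k.+1.
  (* Taking the adjoint outside turns Th^dagger Sh^dagger into (Sh Th)^dagger, with the lower
     triangular factor on the left as [trunc_mul] requires. *)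
  rewrite GE trunc_mul// !trunc_adj -mulmxA -adjmxM -(trunc_mul _ Th lSh).
  by rewrite ShT trunc_id trmx1 map_mx1 mulmx1.
have i1 : (i < k.+1)%N by exact: ltnW.
have := congr1 (fun M => submxblock M (Ordinal i1) (@ord_max k)) GShE.
rewrite mul_mxblock mxblockK trunc_mblock [mblock _ _ k]block_lowerE//= => GSh0.
by rewrite -[RHS]GSh0; apply: eq_bigr => m _; rewrite mblock_adj.
Qed.

(** Since the block (k, k) of [S] is 1, the last term of the block (k, j) of S G is that of [G];
    moved across, it is the right-hand side of the system. *)
Lemma gauss_borel_row k : trunc G k \in unitmx ->
  \mxrow_(j < k) mblock S k j =
  - (\mxrow_(j < k) mblock G k j) *m invmx (trunc G k).
Proof.
case: (GSH) => -[_ S1] _ _ _ uG; apply: (canRL (mulmxK uG)).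
rewrite mul_mxrow_mxblock -mxrowN; apply: eq_mxrow => j; apply/eqP.
have := gauss_borel_left (ltn_ord j).
rewrite mblock_mul big_ord_recr /= S1 mul1mx => /eqP.
by rewrite addr_eq0.
Qed.

(** Here the unknowns stand to the right of [trunc G k], so they are the adjoint blocks of [Sh],
    stacked in a column. *)
Lemma gauss_borel_col k : trunc G k \in unitmx ->
  \mxcol_(i < k) (mblock Sh k i)^t* =
  - (invmx (trunc G k) *m \mxcol_(i < k) mblock G i k).
Proof.
case: (GSH) => _ [_ Sh1] _ _ uG; rewrite -mulmxN; apply: (canRL (mulKmx uG)).
rewrite mul_mxblock_mxrow -mxcolN; apply: eq_mxcol => i; apply/eqP.
have := gauss_borel_right (ltn_ord i).
rewrite big_ord_recr /= Sh1 trmx1 map_mx1 mulmx1 => /eqP.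
by rewrite addr_eq0.
Qed.

Lemma gauss_borel_quasidet k (v : semicv C D) : trunc G k \in unitmx ->
  vblock (semi_mulv S v) k =
    last_quasidet
      (block_mx (trunc G k)                   (\mxcol_(i < k) vblock v i)
                (\mxrow_(j < k) mblock G k j) (vblock v k)).
Proof.
move=> uG; case: (GSH) => -[_ S1] _ _ _.
rewrite /last_quasidet block_mxKul block_mxKur block_mxKdl block_mxKdr.
rewrite vblock_mulv big_ord_recr /= S1 mul1mx -mul_mxrow_mxcol.
by rewrite gauss_borel_row// mulNmx mulNmx addrC.
Qed.

Lemma gauss_borel_quasidet_adj k (v : semicv C D) : trunc G k \in unitmx ->
  (vblock (semi_mulv Sh v) k)^t* =
    last_quasidet
      (block_mx (trunc G k)                       (\mxcol_(i < k) mblock G i k)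
                (\mxrow_(j < k) (vblock v j)^t*) ((vblock v k)^t*)).
Proof.
move=> uG; case: (GSH) => _ [_ Sh1] _ _.
rewrite /last_quasidet block_mxKul block_mxKur block_mxKdl block_mxKdr.
rewrite vblock_mulv big_ord_recr /= Sh1 mul1mx raddfD /= map_mxD addrC.
(* The inverse is grouped with the column of [G] to expose the solution for [Sh]; the adjoint has
   put the row of [v] on its left. *)
congr (_ + _); rewrite -mulmxA -mulmxN -gauss_borel_col// mul_mxrow_mxcol.
by rewrite !raddf_sum /=; apply: eq_bigr => m _; rewrite adjmxM.
Qed.

End GaussBorel.

End Blocks.

Theorem proposition2p9 (R : realType) (D : nat) (D_ge1 : (1 <= D)%N)
    (mu : complex_measure (borel_torus R D) R)
    (mu_qd : quasi_definite mu)
    (S H Sh : semimx R[i] D)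
    (SHSh : gauss_borel (moment mu) S H Sh)
    (k : nat) (z : 'rV[R[i]]_D) (z_neq0 : forall a, z 0 a != 0) :
  let G := moment mu in
  let phi := vblock (semi_mulv S (chi z)) in
  let phih := vblock (semi_mulv Sh (chi z)) in
  phi k =
    last_quasidet
      (block_mx (trunc G k)                  (\mxcol_(i < k) vblock (chi z) i)
                (\mxrow_(j < k) mblock G k j) (vblock (chi z) k))
  /\
  (phih k)^t* =
    last_quasidet
      (block_mx (trunc G k)                        (\mxcol_(i < k) mblock G i k)
                (\mxrow_(j < k) (vblock (chi z) j)^t*) ((vblock (chi z) k)^t*)).
Proof.
have uG : trunc (moment mu) k \in unitmx.
  (* Quasi-definiteness starts at size 1; at k = 0 the truncation is empty, hence invertible. *)
  case: k => [|k]; first by rewrite unitmx_size0// big_ord0.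
  by rewrite unitmxE unitfE mu_qd.
move=> G phi phih; split.
- exact: (gauss_borel_quasidet SHSh).
- exact: (gauss_borel_quasidet_adj SHSh).
Qed.
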